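(* Let $M,N\geq 0$ and $k\geq 1$ be integers with $|M-N|\leq k$. Then $$\sum_{l\in\mathbb{Z}}\binom{M+N}{M-kl}^2 \cos(lx)=\sum_{p\geq 0} b_p(1+\cos x)^p ,$$ where $b_p$ is the cardinality of the set $$B_p=\Big\{(u,v)\in\mathscr{M}_{M,N}\times\mathscr{M}_{N,M}\colon (u,v)\text{ is of class }p\text{ and } -2k<\sum_{j\leq s}(u_j-v_j)<2k \text{ for } s=1,\ldots,M+N\Big\}.$$
   Context: A binary word is a finite word on $\{0,1\}$; for a word $w$, $|w|$ is its length and $|w|_1$ the number of letters $1$ in it. For $m,n\geq 0$, $\mathscr{M}_{m,n}$ is the set of binary words with exactly $m$ letters $1$ and $n$ letters $0$. For a pair $(u,v)$ of binary words of the same length, its $k$-factorization is the factorization $u=u^{(1)}\cdots u^{(s+1)}$, $v=v^{(1)}\cdots v^{(s+1)}$ into consecutive subwords with $s$ as large as possible such that $|u^{(j)}|=|v^{(j)}|$ for all $j$, $|u^{(j)}|_1-|v^{(j)}|_1\in\{k,-k\}$ for $1\leq j\leq s$, and $-k\leq |u^{(s+1)}|_1-|v^{(s+1)}|_1\leq k$. The pair $(u,v)$ is of class $p$ if there are exactly $p$ indices $r\in\{1,\ldots,s+1\}$ with $\sum_{j=1}^r\big(|u^{(j)}|_1-|v^{(j)}|_1\big)\in\{k,-k\}$. Binomial coefficients $\binom{n}{j}$ are $0$ when $j<0$ or $j>n$.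
   Formalization: The class of (u,v) counts indices r in {1,…,s} instead of {1,…,s+1}; the two agree if |M-N|<k, but if |M-N|=k the original count makes the identity false (M=1, N=0, k=1 would give (1+cos x)^2 instead of 1+cos x). *)

(* Defs.v *)
From HB Require Import structures.
From mathcomp Require Import all_boot all_order all_algebra.
From mathcomp Require Import all_classical all_reals all_analysis.

Set Implicit Arguments.
Unset Strict Implicit.
Unset Printing Implicit Defensive.

Import Order.TTheory GRing.Theory Num.Theory.
Local Open Scope ring_scope.

(* The letter 1 is [true] and the letter 0 is [false]. *)
Definition word := seq bool.

Definition ones (w : word) : nat := count_mem true w.

Definition words (m n : nat) : {set (m + n).-tuple bool} :=
  [set w : (m + n).-tuple bool |
    (count_mem true w == m) && (count_mem false w == n)].

Definition excess (u v : word) : int := (ones u)%:Z - (ones v)%:Z.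

Definition pm (k : nat) (z : int) : bool := (z == k%:Z) || (z == - k%:Z).

(* The blocks (u^(j), v^(j)) for j <= s are the items of [f], in order, so that
   s = size f, and the block of index s + 1 is [l], whose words may be empty. *)
Definition k_admissible (k : nat) (u v : word)
    (f : seq (word * word)) (l : word * word) : Prop :=
  [/\ u = flatten (unzip1 (rcons f l)),
      v = flatten (unzip2 (rcons f l)),
      all (fun b => size b.1 == size b.2) (rcons f l),
      all (fun b => pm k (excess b.1 b.2)) f
    & - k%:Z <= excess l.1 l.2 <= k%:Z].

Definition k_factorization (k : nat) (u v : word)
    (f : seq (word * word)) (l : word * word) : Prop :=
  k_admissible k u v f l /\
  forall f' l', k_admissible k u v f' l' -> (size f' <= size f)%N.

Definition partial_excess (bs : seq (word * word)) (r : nat) : int :=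
  \sum_(b <- take r bs) excess b.1 b.2.

(* The number of indices r in {1, ..., n} such that the sum of the excesses of
   the first r blocks is k or -k. *)
Definition hits (k : nat) (bs : seq (word * word)) (n : nat) : nat :=
  count (fun r => pm k (partial_excess bs r)) (iota 1 n).

(* The k-factorization is not unique: the lengths of the blocks may vary when
   u and v share letters, but s and the partial sums do not depend on the
   choice.  The index r ranges over {1, ..., s}.  Letting it range over
   {1, ..., s + 1} gives the same class when |excess u v| < k (hits_last below).
   When excess u v is k or -k the last two partial sums are both equal to it,
   and counting r = s + 1 would count the final visit to k or -k twice.  This
   breaks the identity: M = 1, N = 0, k = 1 would give (1 + cos x)^2 instead
   of 1 + cos x. *)
Definition of_class (k : nat) (u v : word) (p : nat) : Prop :=
  exists f l, k_factorization k u v f l /\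
    hits k (rcons f l) (size f) = p.

Lemma partial_excess_last (k : nat) (u v : word) f l :
  k_admissible k u v f l ->
  partial_excess (rcons f l) (size f).+1 = excess u v.
Proof.
case=> -> -> _ _ _; rewrite /partial_excess take_oversize ?size_rcons //.
elim: (rcons f l) => [|b bs IH]; first by rewrite big_nil.
rewrite big_cons IH /excess /ones /= !count_cat !PoszD opprD.
exact: addrACA.
Qed.

Lemma hits_last (k : nat) (u v : word) f l :
  k_admissible k u v f l -> `|excess u v| < k%:Z ->
  hits k (rcons f l) (size f).+1 = hits k (rcons f l) (size f).
Proof.
move=> /partial_excess_last E lt_k.
rewrite /hits -[X in iota 1 X]addn1 iotaD count_cat /= add1n E /pm.
have nk z : `|z| = k%:Z -> (excess u v == z) = false.
  by move=> zk; apply/negP => /eqP Ez; move: lt_k; rewrite Ez zk ltxx.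
by rewrite !nk ?normrN ?normr_nat ?addn0.
Qed.

(* -2k < (u_1 - v_1) + ... + (u_s - v_s) < 2k for s = 1, ..., n, the j-th
   letters being those of index j - 1. *)
Definition in_strip (k n : nat) (u v : word) : Prop :=
  forall s : nat, (1 <= s <= n)%N ->
    - (2 * k)%N%:Z <
      \sum_(j < s) ((nth false u j : nat)%:Z - (nth false v j : nat)%:Z)
    < (2 * k)%N%:Z.

Definition B (M N k p : nat) :
    {set (M + N).-tuple bool * (N + M).-tuple bool} :=
  [set uv : (M + N).-tuple bool * (N + M).-tuple bool |
    [&& uv.1 \in words M N, uv.2 \in words N M &
      `[< of_class k uv.1 uv.2 p /\ in_strip k (M + N) uv.1 uv.2 >]]].

Definition binz (n : nat) (j : int) : nat :=
  match j with Posz m => 'C(n, m) | Negz _ => 0%N end.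

(* Main.v *)
(* Reading (u, v) from left to right gives a lattice walk u_1 - v_1 + ...; cut
   it each time it has moved by exactly k or -k since the last cut.  This greedy
   cutting is a k-factorization.  Record the sequence E of the signs of its s
   blocks and the remaining excess r, with |r| < k.  Exchanging the two words
   inside a block flips its sign and keeps the total number of letters 1, so for
   given s and r all 2^s sequences E are equally frequent.  It then suffices to
   compare, for each s and r, two sums over E: the weights cos(lx) give
   2^s cos(x/2)^s cos(cx/2), and the sequences whose partial sums stay in
   {-1, 0, 1} give 2^(s/2) (1 + cos x)^ceil(s/2) with s/2 rounded down, where
   M - N - r = k c with c in {-1, 0, 1} of the parity of s (both sums vanish if
   there is no such c).  These agree because 1 + cos x = 2 cos(x/2)^2. *)
Require Import Defs.
From HB Require Import structures.
From mathcomp Require Import all_boot all_order all_algebra.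
From mathcomp Require Import all_classical all_reals all_analysis.
From mathcomp Require Import zify ring lra.
Import Order.TTheory GRing.Theory Num.Theory.
Local Open Scope classical_set_scope.
Local Open Scope ring_scope.

(** * The greedy cutting of a pair of words *)

Definition letter_diff (a b : bool) : int := (a : nat)%:Z - (b : nat)%:Z.

(* [y] is the excess accumulated since the last cut; the result is the list of
   signs of the blocks together with the excess of the unfinished one. *)
Fixpoint scan (k : nat) (y : int) (u v : word) : seq bool * int :=
  match u, v with
  | a :: u', b :: v' =>
      let z := y + letter_diff a b in
      if `|z| == k%:Z
      then let s := scan k 0 u' v' in ((0 < z) :: s.1, s.2)
      else scan k z u' v'
  | _, _ => ([::], y)
  end.

Definition sign (e : bool) : int := if e then 1 else -1.

Definition sign_sum (E : seq bool) : int := \sum_(e <- E) sign e.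

(** * Exchanging the two words up to a checkpoint *)

Lemma big_tuple_cons (V : nmodType) (n : nat) (F : seq bool -> V) :
  \sum_(u : n.+1.-tuple bool) F u =
  \sum_(u : n.-tuple bool) F (true :: u) +
  \sum_(u : n.-tuple bool) F (false :: u).
Proof.
rewrite (reindex (fun p : bool * n.-tuple bool => [tuple of p.1 :: p.2])) /=.
  rewrite -(pair_big xpredT xpredT (fun b (u : n.-tuple bool) => F (b :: u))) /=.
  by rewrite big_bool.
exists (fun u => (thead u, [tuple of behead u])) => [[b u] _|u _] /=.
  by congr pair; apply: val_inj.
by rewrite [RHS]tuple_eta; apply: val_inj.
Qed.

Lemma big_tuple0 (V : nmodType) (F : seq bool -> V) :
  \sum_(u : 0.-tuple bool) F u = F [::].
Proof.
rewrite (big_pred1 [tuple]) // => u.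
by rewrite /= [u]tuple0.
Qed.

Lemma letter_diffC (a b : bool) : letter_diff b a = - letter_diff a b.
Proof. by rewrite /letter_diff opprB. Qed.

Lemma letter_diff_le1 (a b : bool) : `|letter_diff a b| <= 1.
Proof. by case: a; case: b. Qed.

(* The runs from [y] and from [- y] are paired by exchanging the two words up to
   the first checkpoint; beyond it they agree, except for the first sign. *)
Lemma scan_sum_antisym (R : realFieldType) (k n : nat) (hk : (1 <= k)%N)
    (G : nat -> seq bool -> int -> R) (y : int) :
  (forall t s (r : int), `|r| < k%:Z -> \sum_(E : s.-tuple bool) G t E r = 0) ->
  `|y| < k%:Z ->
  let S z := \sum_(u : n.-tuple bool) \sum_(v : n.-tuple bool)
    G (ones u + ones v)%N (scan k z u v).1 (scan k z u v).2 in
  S y + S (- y) = 0.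
Proof.
elim: n G y => [|n IH] G y hG hy S.
  have S0 z : S z = G 0%N [::] z.
    pose F u v := G (ones u + ones v)%N (scan k z u v).1 (scan k z u v).2.
    rewrite /S (big_tuple0 _ (fun u => \sum_(v : 0.-tuple bool) F u v)).
    exact: (big_tuple0 _ (F [::])).
  have h0 z : `|z| < k%:Z -> G 0%N [::] z = 0.
    by move=> /(hG 0%N 0%N); rewrite (big_tuple0 _ (fun E => G 0%N E z)).
  by rewrite !S0 !h0 ?addr0 // normrN.
pose T z (a b : bool) := \sum_(u : n.-tuple bool) \sum_(v : n.-tuple bool)
  G (ones (a :: u) + ones (b :: v))%N
    (scan k z (a :: u) (b :: v)).1 (scan k z (a :: u) (b :: v)).2.
have ST z : S z = T z true true + T z true false + (T z false true + T z false false).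
  pose F u v := G (ones u + ones v)%N (scan k z u v).1 (scan k z u v).2.
  rewrite /S (big_tuple_cons _ _ (fun u => \sum_(v : n.+1.-tuple bool) F u v)).
  by congr (_ + _); rewrite -big_split; apply: eq_bigr => u _;
     rewrite (big_tuple_cons _ _ (F (_ :: u))).
suff hT a b : T y a b + T (- y) b a = 0.
  have := (hT true true, hT true false, hT false true, hT false false).
  by rewrite !ST => -[[[]]]; lra.
pose w : int := y + letter_diff a b.
have wN : - y + letter_diff b a = - w by rewrite letter_diffC -opprD.
(* The first two letters enter the count of ones only through [a + b], which the exchange
   preserves. *)
pose G' t := G (a + b + t)%N.
have onesE (u v : word) (c d : bool) : (c + d = a + b)%N ->
    (ones (c :: u) + ones (d :: v))%N = (a + b + (ones u + ones v))%N.
  by rewrite /ones /= => <-; rewrite !eqb_id addnACA.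
have ab : (b + a = a + b)%N by rewrite addnC.
have [wk|wk] := eqVneq (`|w|) k%:Z; last first.
  have wlt : `|w| < k%:Z.
    by move: wk hy (letter_diff_le1 a b); rewrite /w; lia.
  rewrite -[RHS](IH G' w (fun t => hG _) wlt) /T /= -/w wN !normrN (negPf wk).
  by congr (_ + _); apply: eq_bigr => u _; apply: eq_bigr => v _; rewrite onesE.
(* The paired runs close blocks of opposite signs and both restart at offset 0, so [H] sums over the
   first sign. Its vanishing at length [s] is that of [G] at length [s.+1]. *)
pose H t E r := G' t (true :: E) r + G' t (false :: E) r.
have hH t s r : `|r| < k%:Z -> \sum_(E : s.-tuple bool) H t E r = 0.
  move=> hr; rewrite big_split /= -[RHS](hG (a + b + t)%N s.+1 r hr).
  by rewrite (big_tuple_cons _ _ (fun E => G (a + b + t)%N E r)).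
have k0 : `|0 : int| < k%:Z by lia.
have := IH H 0 hH k0; rewrite /= oppr0 -mulr2n => /eqP.
rewrite mulrn_eq0 => /eqP H0.
rewrite -[RHS]H0 /T /= -/w wN !normrN wk eqxx -big_split.
apply: eq_bigr => u _; rewrite -big_split; apply: eq_bigr => v _ /=.
rewrite !onesE // /H /G'.
have -> : (0 < - w) = ~~ (0 < w) by lia.
by case: (0 < w); rewrite // addrC.
Qed.

(** At [y = 0] the pairing gives twice this sum. An identity over pairs of words is thereby reduced
    to one over sign sequences, for each number of blocks and each remainder. *)
Lemma scan_sum_eq0 (R : realFieldType) (k n : nat) (hk : (1 <= k)%N)
    (G : nat -> seq bool -> int -> R) :
  (forall t s (r : int), `|r| < k%:Z -> \sum_(E : s.-tuple bool) G t E r = 0) ->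
  \sum_(u : n.-tuple bool) \sum_(v : n.-tuple bool)
    G (ones u + ones v)%N (scan k 0 u v).1 (scan k 0 u v).2 = 0.
Proof.
move=> hG; have k0 : `|0 : int| < k%:Z by lia.
have := scan_sum_antisym R k n hk G 0 hG k0.
by rewrite /= oppr0 -mulr2n => /eqP; rewrite mulrn_eq0 => /eqP.
Qed.

(** * Maximality of the greedy cutting *)

Lemma excess_cons (a b : bool) (u v : word) :
  excess (a :: u) (b :: v) = letter_diff a b + excess u v.
Proof. by rewrite /excess /letter_diff /ones /= !eqb_id !PoszD; ring. Qed.

Lemma excess_cat (u1 u2 v1 v2 : word) :
  excess (u1 ++ u2) (v1 ++ v2) = excess u1 v1 + excess u2 v2.
Proof. by rewrite /excess /ones !count_cat !PoszD; ring. Qed.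

(** A cut happens at offset [k] or [- k], so resetting the offset to 0 moves exactly [k] times the
    recorded sign into the first term. *)
Lemma scan_excess (k : nat) (y : int) (u v : word) : size u = size v ->
  y + excess u v = k%:Z * sign_sum (scan k y u v).1 + (scan k y u v).2.
Proof.
elim: u v y => [|a u IH] [|b v] y //=.
  by rewrite /excess /sign_sum big_nil /=; lia.
move=> [/IH E]; rewrite excess_cons addrA; set z := y + _.
case: eqP => zk /=; last exact: E.
have := E 0; rewrite add0r /sign_sum big_cons mulrDr => ->.
by rewrite addrA; congr (_ + _ + _); rewrite /sign; case: ifP; lia.
Qed.

Lemma scan_lt (k : nat) (y : int) (u v : word) :
  (1 <= k)%N -> `|y| < k%:Z -> `|(scan k y u v).2| < k%:Z.
Proof.
move=> hk; elim: u v y => [|a u IH] [|b v] y //= hy.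
case: eqP => zk /=; first by apply: IH; lia.
by apply: IH; move: zk hy (letter_diff_le1 a b); lia.
Qed.

Lemma size_scan (k : nat) (y : int) (u v : word) :
  (size (scan k y u v).1 <= size u)%N.
Proof.
elim: u v y => [|a u IH] [|b v] y //=.
by case: eqP => _ /=; rewrite ?ltnS // ltnW // ltnS.
Qed.

Lemma scan_cat (k : nat) (y : int) (u1 v1 u2 v2 : word) : size u1 = size v1 ->
  (scan k y (u1 ++ u2) (v1 ++ v2)).1 =
  (scan k y u1 v1).1 ++ (scan k (scan k y u1 v1).2 u2 v2).1.
Proof.
elim: u1 v1 y => [|a u IH] [|b v] y //= [/IH E].
by case: eqP => _ /=; rewrite E.
Qed.

(* Every block of excess [k] or [- k] crosses a greedy checkpoint and ends at
   offset 0, since that offset is a multiple of [k] smaller than [k]. *)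
Lemma size_admissible (k : nat) (u v : word) f l : (1 <= k)%N ->
  k_admissible k u v f l -> (size f <= size (scan k 0 u v).1)%N.
Proof.
move=> hk [-> -> hs hf _]; elim: f hs hf => [|b f IH] //= /andP[/eqP hb hs].
move=> /andP[hpm hf]; have {IH} := IH hs hf.
have := scan_excess k 0 _ _ hb; have k0 : `|0 : int| < k%:Z by lia.
have := scan_lt k 0 b.1 b.2 hk k0.
rewrite /= scan_cat //; case: (scan k 0 b.1 b.2) => E r /= hr.
rewrite add0r => Er; have r0 : r = 0.
  have mul_small (c : int) : r = k%:Z * c -> r = 0.
    move: hr => /[swap] ->; rewrite normrM ger0_norm // -[ltRHS]mulr1 ltr_pM2l //.
    by move=> c1; rewrite (_ : c = 0) ?mulr0 //; lia.
  move: hpm; rewrite Er /pm => /orP[] /eqP h.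
    by apply: (mul_small (1 - sign_sum E)); rewrite mulrBr; lia.
  by apply: (mul_small (- 1 - sign_sum E)); rewrite mulrBr; lia.
(* With [r = 0], an empty [E] would give the block excess 0, which is neither [k] nor [- k] since
   [k >= 1]. *)
rewrite r0 size_cat => h; case: E Er => [|e E] Er /=; last by lia.
by move: hpm; rewrite Er r0 /sign_sum big_nil /pm; lia.
Qed.

(** The pair [(u0, v0)] is the unfinished block: it absorbs letters until its excess is [k] or
    [- k], and becomes the last block when the words end. *)
Lemma scan_admissible (k : nat) (u0 v0 u v : word) : (1 <= k)%N ->
  size u0 = size v0 -> size u = size v -> `|excess u0 v0| < k%:Z ->
  exists f l, k_admissible k (u0 ++ u) (v0 ++ v) f l /\
    size f = size (scan k (excess u0 v0) u v).1.
Proof.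
move=> hk; elim: u v u0 v0 => [|a u IH] [|b v] u0 v0 //=.
  move=> h0 _ hlt; exists [::], (u0, v0); split=> //.
  by split; rewrite ?h0 /= ?cats0 ?eqxx //; lia.
move=> h0 [h] hlt.
have ex : excess (rcons u0 a) (rcons v0 b) = excess u0 v0 + letter_diff a b.
  by rewrite -!cats1 excess_cat excess_cons /excess /ones /= addr0.
have h1 : size (rcons u0 a) = size (rcons v0 b) by rewrite !size_rcons h0.
rewrite -ex -!cat_rcons; case: eqP => zk.
  have k0 : `|excess [::] [::]| < k%:Z by rewrite /excess /= subr0; lia.
  have [f [l [[fu fv fs ff fl] sf]]] := IH v [::] [::] erefl h k0.
  exists ((rcons u0 a, rcons v0 b) :: f), l; split; last first.
    by rewrite /= sf /excess /= subr0.
  split=> //=; first by rewrite -fu.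
  - by rewrite -fv.
  - by rewrite h1 eqxx.
  - by rewrite ff andbT /pm; lia.
apply: IH => //; rewrite ex; move: (letter_diff_le1 a b); rewrite ex in zk; lia.
Qed.

(** * The strip condition read at the checkpoints *)

(* The checkpoints [k * (c + sign e_1 + ... + sign e_j)] stay in {-k, 0, k}. *)
Fixpoint confined (c : int) (E : seq bool) : bool :=
  if E is e :: E' then (`|c + sign e| <= 1) && confined (c + sign e) E'
  else true.

(** Between checkpoints the walk stays at distance less than [k] from the last one, [k * c]; as
    [|c| <= 1], it can leave the strip only at a checkpoint. *)
Lemma confined_scan (k : nat) (c y : int) (u v : word) : (1 <= k)%N ->
  size u = size v -> `|c| <= 1 -> `|y| < k%:Z ->
  (forall s : nat, (s <= size u)%N ->
     `|k%:Z * c + y + excess (take s u) (take s v)| < (2 * k)%N%:Z) <->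
  confined c (scan k y u v).1.
Proof.
move=> hk; elim: u v c y => [|a u IH] [|b v] c y //=.
  by move=> _ hc hy; split=> // _ s _; rewrite /excess /=; nia.
move=> [huv] hc hy; set z := y + letter_diff a b.
have tl : (forall s : nat, (s <= (size u).+1)%N ->
     `|k%:Z * c + y + excess (take s (a :: u)) (take s (b :: v))| < (2 * k)%N%:Z) <->
   (forall s : nat, (s <= size u)%N ->
     `|k%:Z * c + z + excess (take s u) (take s v)| < (2 * k)%N%:Z).
  split=> h [|s] hs.
  - by have := h 1%N isT; rewrite /= !take0 excess_cons !addrA.
  - by have := h s.+2 hs; rewrite /= excess_cons !addrA.
  - by rewrite /excess /=; nia.
  - by have := h s hs; rewrite /= excess_cons !addrA.
case: eqP => zk /=; rewrite tl; last first.
  by apply: IH => //; move: (letter_diff_le1 a b) zk; rewrite /z; lia.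
have zE : k%:Z * c + z = k%:Z * (c + sign (0 < z)) + 0.
  by rewrite mulrDr addr0; congr (_ + _); rewrite /sign; case: ifP; lia.
rewrite zE; case: (lerP `|c + sign (0 < z)| 1) => hc' /=.
  by apply: IH => //; lia.
(* The empty remaining prefix is the checkpoint itself, where the walk is already at distance at
   least [2k] from 0. *)
split=> // /(_ 0%N (leq0n _)); rewrite !take0 /excess /= subr0 !addr0.
rewrite normrM ger0_norm // PoszM mulrC ltr_pM2r //; lia.
Qed.

Lemma sum_nth_excess (u v : word) (s : nat) : (s <= size u)%N ->
  size u = size v ->
  \sum_(j < s) ((nth false u j : nat)%:Z - (nth false v j : nat)%:Z) =
  excess (take s u) (take s v).
Proof.
move=> hs huv; elim: s hs => [|s IH] hs.
  by rewrite big_ord0 !take0.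
rewrite big_ord_recr /= IH 1?ltnW // !(take_nth false) -?huv //.
by rewrite -!cats1 excess_cat excess_cons /letter_diff [excess [::] _]subrr addr0.
Qed.

Lemma in_strip_confined (k : nat) (u v : word) : (1 <= k)%N ->
  size u = size v ->
  in_strip k (size u) u v <-> confined 0 (scan k 0 u v).1.
Proof.
move=> hk huv; have k0 : `|0 : int| < k%:Z by lia.
rewrite -(confined_scan k 0 0 u v hk huv isT k0).
have sE s : (s <= size u)%N ->
    k%:Z * 0 + 0 + excess (take s u) (take s v) =
    \sum_(j < s) ((nth false u j : nat)%:Z - (nth false v j : nat)%:Z).
  by move=> hs; rewrite mulr0 !add0r sum_nth_excess.
split=> h s hs.
  rewrite sE //; case: s hs => [|s] hs; first by rewrite big_ord0; lia.
  by have := h s.+1 hs; lia.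
by case/andP: hs => _ hs; have := h s hs; rewrite sE //; lia.
Qed.

(** * The class of a pair in the strip *)

(** Block ends are positions of the walk; this carries the strip bound over to the partial sums. *)
Lemma partial_excess_take (bs : seq (word * word)) (r : nat) :
  all (fun b => size b.1 == size b.2) bs ->
  exists2 m : nat, (m <= size (flatten (unzip1 bs)))%N &
  partial_excess bs r =
  excess (take m (flatten (unzip1 bs))) (take m (flatten (unzip2 bs))).
Proof.
rewrite /partial_excess; elim: bs r => [|b bs IH] [|r] /=;
  try by exists 0%N; rewrite ?big_nil ?take0.
move=> /andP[/eqP hb hbs]; have [m hm E] := IH r hbs.
exists (size b.1 + m)%N; first by rewrite size_cat leq_add2l.
by rewrite big_cons E {2}hb !takeD !take_size_cat // !drop_size_cat // excess_cat.
Qed.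

(* The partial sums of the excesses are multiples of [k] in (-2k, 2k) whose
   quotient by [k] changes parity with each block. *)
Lemma partial_excess_pm (k : nat) (u v : word) f l r : (1 <= k)%N ->
  k_admissible k u v f l -> in_strip k (size u) u v -> (r <= size f)%N ->
  pm k (partial_excess (rcons f l) r) = odd r.
Proof.
move=> hk [hu hv hs hf _] hstrip hr.
have huv : size u = size v.
  rewrite hu hv !size_flatten; congr sumn.
  by elim: (rcons f l) hs => [|b bs IH] //= /andP[/eqP -> /IH ->].
have [c cE odd_c] : exists2 c : int,
    partial_excess (rcons f l) r = k%:Z * c & odd `|c|%N = odd r.
  rewrite /partial_excess -cats1 takel_cat // => {hu hv hs hstrip}.
  elim: r hr => [|r IH] hr.
    by exists 0; rewrite ?take0 ?big_nil ?mulr0.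
  have [c cE odd_c] := IH (ltnW hr).
  rewrite (take_nth ([::], [::])) // -cats1 big_cat big_seq1 /= cE.
  have /orP[/eqP ->|/eqP ->] := all_nthP ([::], [::]) hf r hr.
    by exists (c + 1); [rewrite mulrDr mulr1|rewrite /= -odd_c; lia].
  by exists (c - 1); [rewrite mulrDr mulrN1|rewrite /= -odd_c; lia].
have : `|partial_excess (rcons f l) r| < (2 * k)%N%:Z.
  have [m hm ->] := partial_excess_take _ r hs.
  rewrite -hu -hv; case: m hm => [|m]; first by rewrite !take0 /excess /=; lia.
  rewrite -hu => hm; rewrite -sum_nth_excess //.
  by have := hstrip m.+1 hm; lia.
rewrite cE normrM ger0_norm // PoszM mulrC ltr_pM2r ?ltz_nat // => c2.
rewrite -odd_c /pm; have [->|[->|->]] : c = 0 \/ c = 1 \/ c = -1 by lia.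
- by rewrite mulr0; lia.
- by rewrite mulr1 eqxx.
- by rewrite mulrN1 eqxx orbT.
Qed.

Lemma count_odd_iota (n : nat) : count odd (iota 1 n) = uphalf n.
Proof.
elim: n => [|n IH] //; rewrite -[X in iota 1 X]addn1 iotaD count_cat IH /=.
by lia.
Qed.

(** In the strip the block ends visit [k] or [- k] exactly at odd indices, so the class depends only
    on the number of blocks, and the greedy cutting attains its maximum. *)
Lemma of_class_in_strip (k : nat) (u v : word) (p : nat) : (1 <= k)%N ->
  size u = size v -> in_strip k (size u) u v ->
  of_class k u v p <-> p = uphalf (size (scan k 0 u v).1).
Proof.
move=> hk huv hstrip.
have hitsE f l : k_admissible k u v f l -> hits k (rcons f l) (size f) = uphalf (size f).
  move=> adm; rewrite /hits -count_odd_iota; apply: eq_in_count => r.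
  rewrite mem_iota add1n ltnS => /andP[_ hr].
  exact: (partial_excess_pm _ _ _ _ _ _ hk adm).
have e0 : excess [::] [::] = 0 by rewrite /excess subrr.
have k0 : `|excess [::] [::]| < k%:Z by rewrite e0; lia.
have [f [l [adm sf]]] := scan_admissible k [::] [::] u v hk erefl huv k0.
rewrite e0 in sf.
split=> [[f' [l' [[adm' max'] <-]]]|->].
  rewrite hitsE //; congr uphalf; apply/eqP.
  by rewrite eqn_leq (size_admissible _ _ _ _ _ hk adm') -sf (max' f l).
exists f, l; split; last by rewrite hitsE // sf.
by split=> // f' l' adm'; rewrite sf (size_admissible _ _ _ _ _ hk adm').
Qed.

(** * Sums over sign sequences *)

(* Twice the cosine of half the angle is the eigenvalue of the simple random
   walk at the function [c |-> cos (c x / 2)]. *)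
Lemma sum_signs_cos (R : realType) (x : R) (s : nat) (c : int) :
  \sum_(E : s.-tuple bool) cos ((c - sign_sum E)%:~R * (x / 2)) =
  (2 * cos (x / 2)) ^+ s * cos (c%:~R * (x / 2)).
Proof.
elim: s c => [|s IH] c.
  rewrite (big_tuple0 _ (fun E => cos ((c - sign_sum E)%:~R * (x / 2)))).
  by rewrite /sign_sum big_nil subr0 expr0 mul1r.
rewrite (big_tuple_cons _ _ (fun E => cos ((c - sign_sum E)%:~R * (x / 2)))).
have E1 b : \sum_(E : s.-tuple bool) cos ((c - sign_sum (b :: E))%:~R * (x / 2))
  = (2 * cos (x / 2)) ^+ s * cos ((c - sign b)%:~R * (x / 2)).
  rewrite -IH; apply: eq_bigr => E _.
  by rewrite /sign_sum big_cons opprD addrA.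
rewrite !E1 /= -mulrDr opprK exprSr -mulrA; congr (_ * _).
rewrite intrB intrD mulrBl mulrDl mul1r cosB cosD; ring.
Qed.

Lemma odd_sign_sum (E : seq bool) : odd `|sign_sum E|%N = odd (size E).
Proof.
elim: E => [|e E IH]; first by rewrite /sign_sum big_nil.
by rewrite /sign_sum big_cons /= -IH /sign_sum; case: e => /=; lia.
Qed.

(** From 0, two equal signs leave the allowed range and two opposite ones return to 0. Each pair of
    steps thus contributes a factor 2. *)
Lemma sum_confined (R : pzSemiRingType) (s : nat) (c : int) : `|c| <= 1 ->
  \sum_(E : s.-tuple bool) (confined 0 E && (c == sign_sum E))%:R =
  (if odd s == odd `|c|%N then 2 ^+ s./2 else 0) :> R.
Proof.
move=> hc; pose g (E : seq bool) : R := (confined 0 E && (c == sign_sum E))%:R.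
have g1 s' (E : s'.-tuple bool) e : g [:: e, ~~ e & E] = g E.
  rewrite /g /sign_sum !big_cons /= !addrA.
  by case: e; rewrite /= ?add0r ?subrr ?addNr ?add0r.
have g0 s' (E : s'.-tuple bool) e : g [:: e, e & E] = 0.
  by rewrite /g /=; case: e.
have gS s' e : \sum_(E : s'.+1.-tuple bool) g (e :: E) = \sum_(E : s'.-tuple bool) g E.
  rewrite (big_tuple_cons _ _ (fun E => g (e :: E))).
  case: e; last rewrite addrC.
    rewrite big1 ?add0r => [|E _]; last exact: (g0 _ _ true).
    by apply: eq_bigr => E _; exact: (g1 _ _ true).
  rewrite big1 ?add0r => [|E _]; last exact: (g0 _ _ false).
  by apply: eq_bigr => E _; exact: (g1 _ _ false).
have gSS s' : \sum_(E : s'.+2.-tuple bool) g E = 2 * \sum_(E : s'.-tuple bool) g E.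
  by rewrite (big_tuple_cons _ _ g) !gS mulr_natl mulr2n.
have {hc} hc : c = 0 \/ c = 1 \/ c = -1 by lia.
have g_ s' : (\sum_(E : s'.-tuple bool) g E =
    if odd s' == odd `|c|%N then 2 ^+ s'./2 else 0) /\
  (\sum_(E : s'.+1.-tuple bool) g E =
    if odd s'.+1 == odd `|c|%N then 2 ^+ s'.+1./2 else 0).
  elim: s' => [|s' [IH1 IH2]].
    split.
      by rewrite (big_tuple0 _ g) /g /sign_sum big_nil; case: hc => [->|[->|->]].
    rewrite (big_tuple_cons _ _ g) (big_tuple0 _ (fun E => g (true :: E))).
    rewrite (big_tuple0 _ (fun E => g (false :: E))) /g /sign_sum !big_seq1.
    by case: hc => [->|[->|->]] /=; rewrite ?addr0 ?add0r.
  split=> //; rewrite gSS IH1 /= negbK.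
  by case: ifP; rewrite ?mulr0 // exprS.
by case: (g_ s).
Qed.

Lemma sum_cos_confined (R : realType) (k s : nat) (q : int) (x : R) : (1 <= k)%N ->
  `|q| < (2 * k)%N%:Z ->
  \sum_(E : s.-tuple bool)
    (if ((2 * k)%N%:Z %| q - k%:Z * sign_sum E)%Z
     then cos (((q - k%:Z * sign_sum E) %/ (2 * k)%N%:Z)%Z%:~R * x) else 0) =
  \sum_(E : s.-tuple bool)
    (confined 0 E && (q == k%:Z * sign_sum E))%:R * (1 + cos x) ^+ uphalf s.
Proof.
move=> hk hq; have k0 : k%:Z != 0 by lia.
(* If [k] does not divide [q], every term on both sides is 0. *)
have [/dvdzP[c qE]|hndvd] := boolP (k%:Z %| q)%Z; last first.
  rewrite !big1 // => E _.
    rewrite [X in _ && X](_ : _ = false) ?andbF ?mul0r //.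
    by apply: contraNF hndvd => /eqP ->; rewrite dvdz_mulr.
  rewrite ifN //; apply: contraNN hndvd => /(dvdz_trans _) h.
  have /h : (k%:Z %| (2 * k)%N%:Z)%Z by rewrite PoszM dvdz_mull.
  by move=> h'; rewrite -(subrK (k%:Z * sign_sum E) q) rpredD ?dvdz_mulr.
have hc : `|c| <= 1.
  move: hq; rewrite qE normrM [`|k%:Z|]ger0_norm // PoszM ltr_pM2r ?ltz_nat //; lia.
rewrite -[RHS]mulr_suml.
have -> : \sum_(E : s.-tuple bool) (confined 0 E && (q == k%:Z * sign_sum E))%:R =
    (if odd s == odd `|c|%N then 2 ^+ s./2 else 0) :> R.
  rewrite -sum_confined //; apply: eq_bigr => E _.
  by rewrite qE [k%:Z * _]mulrC (inj_eq (mulIf k0)).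
have cosE (E : s.-tuple bool) :
    (if ((2 * k)%N%:Z %| q - k%:Z * sign_sum E)%Z
     then cos (((q - k%:Z * sign_sum E) %/ (2 * k)%N%:Z)%Z%:~R * x) else 0) =
    if odd s == odd `|c|%N then cos ((c - sign_sum E)%:~R * (x / 2)) else 0 :> R.
  have -> : q - k%:Z * sign_sum E = (c - sign_sum E) * k%:Z.
    by rewrite qE mulrBl [k%:Z * _]mulrC.
  have parity := odd_sign_sum E; rewrite size_tuple in parity.
  rewrite PoszM dvdz_mul2r // divzMpr ?ltz_nat //.
  rewrite -parity.
  (* [sign_sum E] has the parity of [s], so divisibility by 2 does not depend on [E]. *)
  have -> : (odd `|sign_sum E|%N == odd `|c|%N) = (2 %| c - sign_sum E)%Z by lia.
  case: ifP => // /dvdzP[m ->]; rewrite mulzK //.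
  by congr cos; rewrite intrM; field.
under eq_bigr do rewrite cosE.
case: eqP => par; last by rewrite big1_eq mul0r.
rewrite sum_signs_cos.
have -> : cos x = 2 * cos (x / 2) ^+ 2 - 1.
  have {1}-> : x = x / 2 *+ 2 by rewrite -mulr_natr divfK.
  by rewrite cos_mulr2n mulr_natl.
rewrite addrCA subrr addr0.
set C := cos (x / 2).
have -> : cos (c%:~R * (x / 2)) = C ^+ odd s.
  rewrite par; have [->|[->|->]] : c = 0 \/ c = 1 \/ c = -1 by lia.
  - by rewrite mul0r cos0.
  - by rewrite mul1r.
  - by rewrite mulN1r cosN.
(* The exponents match because [s + odd s = 2 * uphalf s] and [s = s./2 + uphalf s]. *)
rewrite (exprMn _ 2 C) (exprMn _ 2 (C ^+ 2)) -exprM -!mulrA [RHS]mulrA -exprD -exprD.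
by congr (_ ^+ _ * _ ^+ _); lia.
Qed.

(** * Both sides as sums over pairs of words *)

Lemma big_tuple_ones (R : pzSemiRingType) (n : nat) (F : nat -> R) :
  \sum_(u : n.-tuple bool) F (ones u) = \sum_(a < n.+1) 'C(n, a)%:R * F a.
Proof.
elim: n F => [|n IH] F.
  by rewrite (big_tuple0 _ (fun u => F (ones u))) big_ord1 mul1r.
rewrite (big_tuple_cons _ _ (fun u => F (ones u))).
rewrite (IH (fun a => F a.+1)) IH [RHS]big_ord_recl.
under [X in _ = _ + X]eq_bigr do rewrite binS natrD mulrDl.
rewrite big_split /= [LHS]addrC [RHS]addrA; congr (_ + _).
rewrite [in LHS]big_ord_recl [in RHS]big_ord_recr /= !bin0.
by rewrite (bin_small (ltnSn n)) mul0r addr0.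
Qed.

Lemma big_tuple_cast (V : nmodType) (m n : nat) (F : word -> V) : m = n ->
  \sum_(u : m.-tuple bool) F u = \sum_(u : n.-tuple bool) F u.
Proof. by move=> ->. Qed.

Lemma in_words (m n : nat) (u : (m + n).-tuple bool) :
  (u \in words m n) = (ones u == m).
Proof.
rewrite inE /ones; have := count_predC (pred1 true) u; rewrite size_tuple.
rewrite (eq_count (_ : predC (pred1 true) =1 pred1 false)) => [|[]] //.
by lia.
Qed.

(** The substitution [a = M - k * l]; all other [l] have a zero binomial coefficient. *)
Lemma fsum_binomials (R : realType) (M n k : nat) (x : R) : (1 <= k)%N ->
  \sum_(l \in [set: int])
     ((binz n (M%:Z - k%:Z * l))%:R ^+ 2 * cos (l%:~R * x)) =
  \sum_(a < n.+1) (if (k%:Z %| M%:Z - a%:Z)%Z then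
    'C(n, a)%:R ^+ 2 * cos (((M%:Z - a%:Z) %/ k%:Z)%Z%:~R * x) else 0).
Proof.
move=> hk; have k0 : k%:Z != 0 by lia.
pose r := [seq ((M%:Z - a%:Z) %/ k%:Z)%Z | a <- iota 0 n.+1 &
  (k%:Z %| M%:Z - a%:Z)%Z].
rewrite (fsbigE r) => [|||l _ lr].
- under eq_bigl do rewrite in_setT.
  rewrite big_map big_filter -big_mkcond /= -(big_mkord
    (fun a : nat => (k%:Z %| M%:Z - a%:Z)%Z)
    (fun a : nat => 'C(n, a)%:R ^+ 2 * cos (((M%:Z - a%:Z) %/ k%:Z)%Z%:~R * x))).
  rewrite /index_iota subn0; apply: eq_bigr => a /dvdzP[l aE].
  by rewrite aE mulzK // [k%:Z * l]mulrC -aE subKr.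
- rewrite map_inj_in_uniq ?filter_uniq ?iota_uniq // => a b.
  rewrite !mem_filter => /andP[/dvdzP[l1 E1] _] /andP[/dvdzP[l2 E2] _].
  by rewrite E1 E2 !mulzK //; lia.
- by [].
- case E : (M%:Z - k%:Z * l) => [a|a]; last by rewrite /= expr0n mul0r.
  have [an|an] := leqP a n; last by rewrite /= bin_small // expr0n mul0r.
  case/negP: lr; apply/mapP; exists a; last first.
    by rewrite -E subKr mulrC mulzK.
  by rewrite mem_filter mem_iota add0n ltnS an leq0n -E subKr dvdz_mulr.
Qed.

(* Pairs of words with excess congruent to [M - N] modulo [2k]: [l] is read off
   as [(M - ones u) / k]. *)
Lemma sum_binomials (R : realType) (M N k : nat) (x : R) : (1 <= k)%N ->
  \sum_(l \in [set: int])
     ((binz (M + N) (M%:Z - k%:Z * l))%:R ^+ 2 * cos (l%:~R * x)) =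
  \sum_(u : (M + N).-tuple bool) \sum_(v : (M + N).-tuple bool)
    (if (ones u + ones v == M + N)%N then
      if ((2 * k)%N%:Z %| M%:Z - N%:Z - excess u v)%Z then
        cos (((M%:Z - N%:Z - excess u v) %/ (2 * k)%N%:Z)%Z%:~R * x)
      else 0 else 0).
Proof.
move=> hk; have k0 : 0 < k%:Z by lia.
rewrite fsum_binomials //; set n := (M + N)%N.
pose F (a : nat) : R := if (k%:Z %| M%:Z - a%:Z)%Z then
    cos (((M%:Z - a%:Z) %/ k%:Z)%Z%:~R * x) else 0.
pose H (a b : nat) : R := if (a + b == n)%N then F a else 0.
transitivity (\sum_(u : n.-tuple bool) \sum_(v : n.-tuple bool) H (ones u) (ones v)).
  under [RHS]eq_bigr do rewrite big_tuple_ones.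
  rewrite (big_tuple_ones _ _ (fun a => \sum_(b < n.+1) 'C(n, b)%:R * H a b)).
  apply: eq_bigr => a _; have an : (n - a < n.+1)%N by rewrite ltnS leq_subr.
  (* Only [b = n - a] survives, and the symmetry of binomial coefficients produces the square. *)
  rewrite (bigD1 (Ordinal an)) //= big1 ?addr0 => [|b hb].
    rewrite /H subnKC -1?ltnS // eqxx bin_sub -1?ltnS // /F.
    by case: ifP; rewrite ?mulr0 // expr2 mulrA.
  rewrite /H ifN ?mulr0 //; apply: contraNneq hb => /(canRL (addKn a)) ba.
  exact/eqP/val_inj.
apply: eq_bigr => u _; apply: eq_bigr => v _; rewrite /H.
case: eqP => // uv; rewrite /F.
have -> : M%:Z - N%:Z - excess u v = 2 * (M%:Z - (ones u)%:Z).
  by rewrite /excess; move: (ones u) (ones v) uv => a b; rewrite /n; lia.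
by rewrite PoszM dvdz_mul2l // divzMpl.
Qed.

Lemma fsum_classes (R : realType) (M N k : nat) (y : R) : (1 <= k)%N ->
  \sum_(p \in [set: nat]) (#|B M N k p|%:R * y ^+ p) =
  \sum_(u : (M + N).-tuple bool) \sum_(v : (M + N).-tuple bool)
    (if (ones u + ones v == M + N)%N then
      (confined 0 (scan k 0 u v).1 && (M%:Z - N%:Z == excess u v))%:R *
        y ^+ uphalf (size (scan k 0 u v).1)
      else 0).
Proof.
move=> hk; set n := (M + N)%N.
pose h (u v : word) := uphalf (size (scan k 0 u v).1).
pose Q (u v : word) := [&& ones u == M, ones v == N & confined 0 (scan k 0 u v).1].
have h_lt (u : n.-tuple bool) (v : word) : (h u v < n.+1)%N.
  have := size_scan k 0 u v; rewrite size_tuple ltnS; apply: leq_trans.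
  by rewrite /h; lia.
have BE p : #|B M N k p|%:R = \sum_(u : n.-tuple bool) \sum_(v : (N + M).-tuple bool)
    (Q u v && (p == h u v))%:R :> R.
  rewrite -sum1_card natr_sum big_mkcond /= pair_big /=.
  apply: eq_bigr => -[u v] _; rewrite inE /= !in_words /Q -!andbA.
  case: eqP => //= uM; case: eqP => //= vN.
  have huv : size u = size v by rewrite !size_tuple addnC.
  have := in_strip_confined k u v hk huv.
  have := of_class_in_strip k u v p hk huv.
  rewrite size_tuple => hcl hst.
  rewrite (_ : `[< _ >] = confined 0 (scan k 0 u v).1 && (p == h u v)).
    by case: (_ && _).
  apply/asboolP/andP => [[/hcl hp hs]|[/hst hs /eqP hp]].
    by split; [exact/hst|apply/eqP/hp].
  by split=> //; apply/hcl.
(* There are at most [n] blocks, so no pair has a class above [n]. *)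
rewrite -(fsbig_widen `I_n.+1) //; last first.
  move=> p [_ /= hp]; rewrite BE big1 ?mul0r // => u _; rewrite big1 // => v _.
  case: eqP => [ph|]; last by rewrite andbF.
  by case: hp; rewrite ph; exact: h_lt.
rewrite -fsbig_ord.
under eq_bigr do rewrite BE mulr_suml.
rewrite exchange_big /=; apply: eq_bigr => u _.
under eq_bigr do rewrite mulr_suml.
rewrite exchange_big /=.
have sumE (v : word) : \sum_(p < n.+1) (Q u v && (nat_of_ord p == h u v))%:R * y ^+ p =
   (Q u v)%:R * y ^+ h u v :> R.
  rewrite (bigD1 (Ordinal (h_lt u v))) //= eqxx andbT big1 ?addr0 // => p hp.
  rewrite (_ : (_ == _) = false) ?andbF ?mul0r //.
  by apply: contraNF hp => /eqP hp; apply/eqP/val_inj.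
under eq_bigr do rewrite sumE.
rewrite (big_tuple_cast _ _ _ (fun v => (Q u v)%:R * y ^+ h u v) (addnC N M)).
apply: eq_bigr => v _; rewrite /Q /h /excess.
(* The two counts are determined by their sum [M + N] and their difference [M - N]. *)
have -> : [&& ones u == M, ones v == N & confined 0 (scan k 0 u v).1] =
    (ones u + ones v == n)%N && (confined 0 (scan k 0 u v).1 &&
      (M%:Z - N%:Z == (ones u)%:Z - (ones v)%:Z)).
  by move: (ones u) (ones v) (confined _ _) => a b [|]; rewrite /n; lia.
by case: ifP; rewrite ?mul0r.
Qed.

(* Both sums have finite support, so that they are genuine finite sums. *)
Theorem theorem2p3 (R : realType) (M N k : nat) (hk : (1 <= k)%N)
    (hMN : `|M%:Z - N%:Z| <= k%:Z) (x : R) :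
  \sum_(l \in [set: int])
     ((binz (M + N) (M%:Z - k%:Z * l))%:R ^+ 2 * cos (l%:~R * x)) =
  \sum_(p \in [set: nat]) (#|B M N k p|%:R * (1 + cos x) ^+ p).
Proof.
rewrite sum_binomials // fsum_classes //.
pose P (E : seq bool) (r : int) : R :=
  if ((2 * k)%N%:Z %| M%:Z - N%:Z - r - k%:Z * sign_sum E)%Z
  then cos (((M%:Z - N%:Z - r - k%:Z * sign_sum E) %/ (2 * k)%N%:Z)%Z%:~R * x)
  else 0.
pose Q (E : seq bool) (r : int) : R :=
  (confined 0 E && (M%:Z - N%:Z - r == k%:Z * sign_sum E))%:R *
    (1 + cos x) ^+ uphalf (size E).
(* The difference of the two sides, restricted to pairs with [M + N] letters 1 in total, a condition
   invariant under exchange. *)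
pose G t E r : R := if t == (M + N)%N then P E r - Q E r else 0.
have hG t s (r : int) : `|r| < k%:Z -> \sum_(E : s.-tuple bool) G t E r = 0.
  move=> hr; rewrite /G; case: eqP => [_|_]; last by rewrite big1_eq.
  rewrite big_split /= sumrN; apply/eqP; rewrite subr_eq0; apply/eqP.
  (* The bound [|M - N - r| < 2k] combines [|M - N| <= k] with [|r| < k]. *)
  rewrite sum_cos_confined //; last by lia.
  by apply: eq_bigr => E _; rewrite /Q size_tuple.
apply/eqP; rewrite -subr_eq0; apply/eqP.
rewrite -[RHS](scan_sum_eq0 R k (M + N) hk G hG) -sumrB.
apply: eq_bigr => u _; rewrite -sumrB; apply: eq_bigr => v _.
rewrite /G; case: eqP => _; last by rewrite subr0.
have huv : size u = size v by rewrite !size_tuple.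
have := scan_excess k 0 u v huv; rewrite add0r => exE.
rewrite /P /Q [_ - (scan k 0 u v).2 == _]subr_eq -exE.
have -> : M%:Z - N%:Z - (scan k 0 u v).2 - k%:Z * sign_sum (scan k 0 u v).1 =
  M%:Z - N%:Z - excess u v by rewrite exE; ring.
by [].
Qed.
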